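(* Let $d\ge1$ and $m_1,\dots,m_d$ be positive integers, and let $G$ be the toroidal grid $Q^{\mathrm{Tor}}_{2m_1,\dots,2m_d}=C_{2m_1}\square\cdots\square C_{2m_d}$, with vertex set $\prod_{i=1}^d[2m_i]$, carrying the boustrophedon labelling, and let $\mathcal{O}$ direct every edge from its lower-labelled to its higher-labelled endpoint. Give every vertex weight $x$ and every edge along the $s$-th coordinate direction weight $a_s$. Then the partition function of the monopole-dimer (loop-vertex) model on $(G,\mathcal{O})$ is $$\prod_{i_1=1}^{m_1}\cdots\prod_{i_d=1}^{m_d}\Big(x^2+\sum_{s=1}^{d}4a_s^2\sin^2\frac{(2i_s-1)\pi}{2m_s}\Big)^{2^{d-1}}.$$
   Context: $C_n$ is the cycle on vertices $1,\dots,n$ (edges $\{p,p+1\}$ and $\{1,n\}$). The Cartesian product $G_1\square\cdots\square G_k$ has vertex set $V(G_1)\times\cdots\times V(G_k)$, two vertices being adjacent iff they differ in exactly one coordinate $i$ and those $i$-th coordinates are adjacent in $G_i$; such an edge is ''along the $i$-th coordinate direction''. Boustrophedon labelling of a grid with side lengths $n_1,\dots,n_d$: for $d=1$ vertex $p$ gets label $p$; for $d>1$, with $N=n_1\cdots n_{d-1}$ and $L_{d-1}$ the labelling of the $(d-1)$-dimensional grid, vertex $(v_1,\dots,v_d)$ gets label $(v_d-1)N+L_{d-1}(v_1,\dots,v_{d-1})$ if $v_d$ is odd and $(v_d-1)N+N+1-L_{d-1}(v_1,\dots,v_{d-1})$ if $v_d$ is even. Loop-vertex (monopole-dimer) model on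 an oriented graph $(G,\mathcal{O})$ with vertex weights $x(v)$ and edge weights $a_{v,v'}=a_{v',v}$: $\mathrm{sgn}(v,v')=1$ if $v\to v'$ in $\mathcal{O}$ and $-1$ if $v'\to v$. A configuration is a collection of vertex-disjoint directed cycles of even length $\ge4$ (the two directions of a cycle giving different configurations), doubled edges (loops of length 2), and isolated vertices, such that every vertex lies in exactly one loop or is isolated. A loop $(v_0,\dots,v_{2k}=v_0)$ has weight $-\prod_{i=0}^{2k-1}\mathrm{sgn}(v_i,v_{i+1})a_{v_i,v_{i+1}}$ (a doubled edge $\{u,v\}$ has weight $a_{u,v}^2$); a configuration has weight the product of its loop weights and of $x(v)$ over isolated vertices. The partition function is the sum of the weights of all configurations.
   Formalization: When m_s = 1, C_2 is read as two parallel edges, so adjacent vertices in direction s get total edge weight 2a_s; with a single edge of weight a_s the formula fails (d = 1, m_1 = 1: x^2 + a^2 instead of x^2 + 4a^2). All cases m_s ≥ 2 are as stated. *)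

(* Defs.v *)
From mathcomp Require Import all_boot all_order all_algebra.
From mathcomp Require Import all_classical all_reals all_analysis.

Set Implicit Arguments.
Unset Strict Implicit.
Unset Printing Implicit Defensive.

Import Order.TTheory GRing.Theory Num.Theory.

Local Open Scope ring_scope.

(* Vertices p, q : 'I_n stand for p + 1, q + 1 in {1, ..., n}.  The edge list
   of C_n consists of {p, p + 1} for 1 <= p < n, and {1, n}; for n = 2 it
   contains {1, 2} twice. *)
Definition cycle_mult (n : nat) (p q : 'I_n) : nat :=
  ((p.+1 == q) || (q.+1 == p)) +
  (((p == 0 :> nat) && (q.+1 == n)) || ((q == 0 :> nat) && (p.+1 == n))).

Definition cycle_adj (n : nat) : rel 'I_n := fun p q => (0 < cycle_mult p q)%N.

Section CartesianProduct.
Variables (I : finType) (V : I -> finType) (e : forall i, rel (V i)).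

Definition along (i : I) : rel {dffun forall i, V i} :=
  fun u v => [forall j, (u j != v j) == (j == i)] && e (u i) (v i).

Definition cart_adj : rel {dffun forall i, V i} :=
  fun u v => [exists i, along i u v].

End CartesianProduct.

(* Here the coordinates v i are the 1-based ones.  The grid of dimension 0 has
   one vertex, labelled 1; the recursion step then gives label v_1 in
   dimension 1. *)
Fixpoint boustrophedon (d : nat) : ('I_d -> nat) -> ('I_d -> nat) -> nat :=
  match d with
  | 0 => fun _ _ => 1%N
  | d'.+1 => fun n v =>
      let init (f : 'I_d'.+1 -> nat) (i : 'I_d') := f (widen_ord (leqnSn d') i) in
      let N := (\prod_(i < d') init n i)%N in
      let L := boustrophedon (init n) (init v) in
      let p := v ord_max in
      if odd p then (p.-1 * N + L)%N else (p.-1 * N + N + 1 - L)%N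
  end.

Section LoopVertexModel.
Variables (R : comNzRingType) (V : finType).
Variables (adj : rel V) (O : rel V) (x : V -> R) (a : V -> V -> R).

Definition sgn (u v : V) : R := if O u v then 1 else if O v u then -1 else 0.

(* A directed cycle is represented by its set of arcs, so that it has no
   distinguished starting point.  A sequence of length 2 gives the doubled edge
   {(u, v), (v, u)}, with no choice of direction. *)
Definition arcs (c : seq V) : {set V * V} := [set (u, next c u) | u in c].

Definition is_loop (C : {set V * V}) : Prop :=
  exists c : seq V, [/\ (0 < size c)%N, ~~ odd (size c), ucycle adj c & C = arcs c].

Definition support (C : {set V * V}) : {set V} := [set b.1 | b in C].

Definition is_config (S : {set {set V * V}}) : Prop :=
  (forall C, C \in S -> is_loop C) /\
  (forall C D, C \in S -> D \in S -> C != D -> [disjoint support C & support D]).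

(* For the doubled edge {u, v} this is a u v * a v u, because the two signs are
   opposite. *)
Definition loop_weight (C : {set V * V}) : R :=
  - \prod_(b in C) (sgn b.1 b.2 * a b.1 b.2).

Definition config_weight (S : {set {set V * V}}) : R :=
  \prod_(C in S) loop_weight C *
  \prod_(v | v \notin \bigcup_(C in S) support C) x v.

Definition partition_function : R :=
  \sum_(S : {set {set V * V}} | `[< is_config S >]) config_weight S.

End LoopVertexModel.

Section Torus.
Variables (d : nat) (m : 'I_d -> nat).

Definition torus : finType := {dffun forall i : 'I_d, 'I_(2 * m i)}.

Definition torus_along (s : 'I_d) : rel torus :=
  along (fun i => @cycle_adj (2 * m i)) s.

Definition torus_adj : rel torus := cart_adj (fun i => @cycle_adj (2 * m i)).

Definition torus_label (v : torus) : nat :=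
  boustrophedon (fun i => 2 * m i)%N (fun i => (v i).+1).

Definition torus_orientation : rel torus :=
  fun u v => torus_adj u v && (torus_label u < torus_label v)%N.

(* The model has one weight per pair of vertices: the total weight of the edges
   joining them.  Two adjacent vertices are joined by a single edge, of weight
   a s, except when 2 * m s = 2, where they are joined by the two parallel edges
   of C_2. *)
Definition torus_edge_weight (R : comNzRingType) (a : 'I_d -> R) (u v : torus) : R :=
  \sum_(s < d | torus_along s u v) a s *+ cycle_mult (u s) (v s).

End Torus.

(* Main.v *)
Require Import Defs.
From mathcomp Require Import all_boot all_order all_algebra all_fingroup.
From mathcomp Require Import all_classical all_reals all_analysis.
From mathcomp Require Import ring lra zify.

(* The partition function is the determinant of x + A, with A the signed
   weighted adjacency matrix: in the Leibniz expansion the permutations with an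
   odd cycle of length at least 3 cancel in pairs, because A is skew, and the
   others are the configurations.  For the boustrophedon orientation of the
   torus, A = \sum_s a_s D_s with
   D_s = 1 (x) .. (x) 1 (x) T (x) P (x) .. (x) P, where T is the antiperiodic
   difference f(p + 1) - f(p - 1) in direction s and P is the diagonal matrix of
   the (-1)^p, which anticommutes with T.  Hence the D_s anticommute and
   (x - A)(x + A) = x^2 - \sum_s a_s^2 D_s^2, which is diagonal in the tensor
   product of the bases cos(theta_j p) + sin(theta_j p),
   theta_j = (2j - 1) pi / 2m, with T^2 = - 4 sin^2 theta_j.  This gives the
   square of det (x + A), and the square root has no sign ambiguity because both
   sides are monic in x. *)

Set Implicit Arguments.
Unset Strict Implicit.
Unset Printing Implicit Defensive.

Import Order.TTheory GRing.Theory Num.Theory.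

Local Open Scope ring_scope.

(** * Permutations with an odd cycle cancel *)

Section PorbitProducts.
Variables (R : comNzRingType) (V : finType).
Implicit Types (s : {perm V}) (P : {set V}).

Lemma porbit_step s u : porbit s (s u) = porbit s u.
Proof. by have := porbit_perm s 1 u; rewrite expg1. Qed.

Lemma porbits_eq s P u : P \in porbits s -> (porbit s u == P) = (u \in P).
Proof. by case/imsetP=> y _ ->; rewrite eq_porbit_mem. Qed.

Lemma mem_porbits s u : porbit s u \in porbits s.
Proof. exact: imset_f. Qed.

Lemma porbits_stable s P u : P \in porbits s -> (s u \in P) = (u \in P).
Proof. by move=> PP; rewrite -!(porbits_eq _ PP) porbit_step. Qed.

Lemma porbit_fixed s u : (1 < #|porbit s u|)%N = (s u != u).
Proof.
apply/idP/idP => [|suu]; last first.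
  rewrite (cardsD1 u) porbit_id (cardsD1 (s u)) !inE suu /=.
  by rewrite -porbit_step porbit_id.
apply: contraTneq => suu; rewrite -leqNgt -(cards1 u) subset_leq_card //.
apply/fintype.subsetP => y; rewrite porbit_traject; move: (#|_|) => n.
case/trajectP => i _ ->; rewrite inE; apply/eqP.
by elim: i => //= i ->.
Qed.

Lemma porbits_moved s P u :
  P \in porbits s -> (1 < #|P|)%N -> u \in P -> s u != u.
Proof. by move=> PP c; rewrite -(porbits_eq _ PP) -porbit_fixed => /eqP ->. Qed.

Lemma prod_porbits s (F : V -> R) :
  \prod_v F v = \prod_(P in porbits s) \prod_(v in P) F v.
Proof.
rewrite (partition_big_imset (porbit s)) /=; apply: eq_bigr => P PP.
by apply: eq_bigl => v; rewrite porbits_eq.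
Qed.

(** The parity of [s] is that of [#|V|] plus the number of orbits: [(-1) ^+ #|V|] splits over the
    orbits, and each orbit adds one minus sign. *)
Lemma sign_porbits s :
  (-1) ^+ s = \prod_(P in porbits s) - ((-1) ^+ #|P|) :> R.
Proof.
rewrite prodrN /odd_perm signr_addb !signr_odd mulrC; congr (_ * _).
rewrite -[LHS]prodr_const (prod_porbits s); apply: eq_bigr => P _.
by rewrite prodr_const.
Qed.

Lemma prod_perm_stable s P (F : V -> R) : P \in porbits s ->
  \prod_(v in P) F v = \prod_(v in P) F (s v).
Proof.
move=> PP; rewrite (reindex_inj (@perm_inj _ s)).
by apply: eq_bigl => v; rewrite porbits_stable.
Qed.

End PorbitProducts.

Section ReverseOrbit.
Variables (V : finType).
Implicit Types (s : {perm V}) (C : {set V}).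

Definition reverse_fun s C u := if s u \in C then s^-1%g u else s u.

Fact reverse_inj s x : injective (reverse_fun s (porbit s x)).
Proof.
have H y : (s^-1%g y \in porbit s x) = (y \in porbit s x).
  by rewrite -(porbits_stable _ (mem_porbits s x)) permKV.
move=> u v; rewrite /reverse_fun !(porbits_stable _ (mem_porbits s x)).
case: ifP => hu; case: ifP => hv.
- exact: perm_inj.
- by move=> E; move: hu; rewrite -H E (porbits_stable _ (mem_porbits s x)) hv.
- by move=> E; move: hv; rewrite -H -E (porbits_stable _ (mem_porbits s x)) hu.
- exact: perm_inj.
Qed.

Definition reverse s x : {perm V} := perm (@reverse_inj s x).

Lemma reverseE s x u :
  reverse s x u = if u \in porbit s x then s^-1%g u else s u.
Proof. by rewrite permE /reverse_fun porbits_stable // mem_porbits. Qed.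

(** Powers of the reversal act on [u] either all as powers of [s^-1] or all as powers of [s],
    because orbits are stable; and [s^-1] has the orbits of [s]. *)
Lemma porbit_reverse s x u : porbit (reverse s x) u = porbit s u.
Proof.
have H y : (s^-1%g y \in porbit s x) = (y \in porbit s x).
  by rewrite -(porbits_stable _ (mem_porbits s x)) permKV.
have E i : (reverse s x ^+ i)%g u =
    if u \in porbit s x then (s^-1 ^+ i)%g u else (s ^+ i)%g u.
  elim: i => [|i IH]; first by rewrite !expg0 perm1 if_same.
  rewrite expgSr permM IH reverseE; case hu: (u \in porbit s x).
    by rewrite -(porbitV s x) -eq_porbit_mem porbit_perm eq_porbit_mem porbitV hu expgSr permM.
  by rewrite -eq_porbit_mem porbit_perm eq_porbit_mem hu expgSr permM.
case hu: (u \in porbit s x) in E.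
  rewrite -[RHS]porbitV; apply/setP => y.
  by apply/porbitP/porbitP => -[i ->]; exists i; rewrite E.
by apply/setP => y; apply/porbitP/porbitP => -[i ->]; exists i; rewrite E.
Qed.

Lemma porbits_reverse s x : porbits (reverse s x) = porbits s.
Proof. by apply: eq_imset => u; rewrite porbit_reverse. Qed.

Lemma reverseK s x : reverse (reverse s x) x = s.
Proof.
apply/permP => u; rewrite reverseE porbit_reverse.
case: ifP => hu; last by rewrite reverseE hu.
apply: (@perm_inj _ (reverse s x)); rewrite permKV reverseE.
by rewrite porbits_stable ?mem_porbits // hu permK.
Qed.

(** Fixed points are left out: they stand for isolated vertices, and reversing them changes
    nothing. *)
Definition odd_orbit s u := odd #|porbit s u| && (1 < #|porbit s u|)%N.

(* Reversing one odd orbit keeps the orbits, hence the choice of that orbit and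
   the sign of the permutation, but negates the product of the entries of a skew
   matrix. *)
Definition reverse_first s :=
  if [pick u | odd_orbit s u] is Some u then reverse s u else s.

Lemma odd_orbit_reverse s x : odd_orbit (reverse s x) =1 odd_orbit s.
Proof. by move=> u; rewrite /odd_orbit porbit_reverse. Qed.

Lemma reverse_firstK : involutive reverse_first.
Proof.
move=> s; rewrite {2}/reverse_first.
case Ep: [pick u | odd_orbit s u] => [u|]; rewrite /reverse_first.
  by rewrite (eq_pick (odd_orbit_reverse s u)) Ep reverseK.
by rewrite Ep.
Qed.

End ReverseOrbit.

Section EvenOrbits.
Variables (R : numDomainType) (V : finType) (K : V -> V -> R).
Hypothesis Kskew : forall u v, u != v -> K v u = - K u v.
Implicit Types (s : {perm V}) (P : {set V}).

Definition perm_term s : R := (-1) ^+ s * \prod_v K v (s v).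

(** This includes the orbit's share [- (-1) ^+ #|P|] of the sign, with the power distributed over
    the entries. *)
Definition orbit_term s P : R := - \prod_(v in P) - K v (s v).

Lemma perm_term_orbits s :
  perm_term s = \prod_(P in porbits s) orbit_term s P.
Proof.
rewrite /perm_term sign_porbits (prod_porbits s) -big_split /=.
by apply: eq_bigr => P _; rewrite /orbit_term prodrN mulNr.
Qed.

Lemma orbit_term_even s P : ~~ odd #|P| ->
  orbit_term s P = - \prod_(v in P) K v (s v).
Proof. by move=> hP; rewrite /orbit_term prodrN -signr_odd (negbTE hP) mul1r. Qed.

(** After the shift of [v] to [s v], the reversed orbit reads the entries [K (s v) v], so skewness
    changes the sign of an odd number of factors. *)
Lemma orbit_term_reverse s x : odd_orbit s x ->
  orbit_term (reverse s x) (porbit s x) = - orbit_term s (porbit s x).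
Proof.
case/andP => o c; rewrite /orbit_term !opprK (prod_perm_stable _ (mem_porbits s x)).
rewrite [RHS]prodrN -signr_odd o mulN1r; congr (- _).
apply: eq_bigr => v hv; rewrite reverseE porbits_stable ?mem_porbits // hv permK.
by rewrite Kskew ?opprK // eq_sym (porbits_moved (mem_porbits s x)).
Qed.

Lemma perm_term_reverse s x : odd_orbit s x ->
  perm_term (reverse s x) = - perm_term s.
Proof.
move=> h; rewrite !perm_term_orbits porbits_reverse.
rewrite (bigD1 (porbit s x)) ?mem_porbits //= orbit_term_reverse // mulNr.
rewrite [in RHS](bigD1 (porbit s x)) ?mem_porbits //=.
congr (- (_ * _)); apply: eq_bigr => P /andP[PP nP]; rewrite /orbit_term.
congr (- _); apply: eq_bigr => v hv; rewrite reverseE.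
have /eqP E : porbit s v == P by rewrite porbits_eq.
by rewrite -eq_porbit_mem E (negbTE nP).
Qed.

Definition has_odd_orbit s := [exists u, odd_orbit s u].

(** Reindexing by the involution [reverse_first] turns the sum into its negative, and the
    characteristic is 0. *)
Lemma sum_odd_orbits : \sum_(s | has_odd_orbit s) perm_term s = 0.
Proof.
set S := LHS; suff E : S = - S.
  by apply/eqP; rewrite -[_ == 0]/((2 == 0)%N || (S == 0)) -mulrn_eq0 mulr2n {1}E addNr.
rewrite {1}/S (reindex_inj (inv_inj (@reverse_firstK V))) /S -sumrN.
apply: eq_big => s.
  rewrite /has_odd_orbit /reverse_first; case: pickP => // u hu.
  exact/eq_existsb/odd_orbit_reverse.
rewrite /has_odd_orbit /reverse_first; case: pickP => [u hu _|hs].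
  exact: perm_term_reverse.
by move=> /existsP[u]; rewrite hs.
Qed.

Lemma sum_even_orbits :
  \sum_s perm_term s = \sum_(s | ~~ has_odd_orbit s) perm_term s.
Proof. by rewrite (bigID has_odd_orbit) /= sum_odd_orbits add0r. Qed.

Lemma perm_term_even s : ~~ has_odd_orbit s ->
  perm_term s = \prod_(P in porbits s | (1 < #|P|)%N) (- \prod_(v in P) K v (s v))
                * \prod_(v | s v == v) K v v.
Proof.
move=> /existsPn hs; rewrite perm_term_orbits (bigID (fun P => 1 < #|P|)%N) /=.
congr (_ * _).
  apply: eq_bigr => P /andP[/imsetP[u _ ->] c]; apply: orbit_term_even.
  by have := hs u; rewrite /odd_orbit c andbT.
(* The diagonal product is regrouped by orbits; an orbit with more than one element has no fixed
   point and contributes 1. *)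
rewrite [RHS]big_mkcond (prod_porbits s) [RHS](bigID (fun P => 1 < #|P|)%N) /=.
rewrite [X in _ = X * _]big1 ?mul1r => [|P /andP[PP c]]; last first.
  by apply: big1 => v hv; rewrite (negbTE (porbits_moved PP c hv)).
apply: eq_bigr => P /andP[/imsetP[u _ ->] c].
rewrite porbit_fixed negbK in c; have := c; rewrite -[_ == _]negbK -porbit_fixed.
move=> c1; have -> : porbit s u = [set u].
  apply/eqP; rewrite eq_sym eqEcard finset.sub1set porbit_id cards1 /=.
  by rewrite leqNgt.
by rewrite /orbit_term !big_set1 c opprK (eqP c).
Qed.

End EvenOrbits.

(** * Configurations and permutations *)

Section OrbitConfig.
Variables (V : finType) (adj : rel V).
Implicit Types (s : {perm V}) (P : {set V}) (S : {set {set V * V}}).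

Definition orbit_arcs s P : {set V * V} := [set (u, s u) | u in P].

(** An orbit of length 2 yields the doubled edge, and reversing a longer orbit yields the other
    direction of the same cycle. *)
Definition orbit_config s : {set {set V * V}} :=
  orbit_arcs s @: [set P in porbits s | (1 < #|P|)%N].

Lemma support_orbit_arcs s P : Defs.support (orbit_arcs s P) = P.
Proof.
by rewrite /Defs.support /orbit_arcs -imset_comp (eq_imset (g := id)) ?imset_id.
Qed.

Lemma orbit_arcs_inj s : injective (orbit_arcs s).
Proof. by move=> P Q E; rewrite -(support_orbit_arcs s P) E support_orbit_arcs. Qed.

Lemma orbit_configP s C :
  reflect (exists2 u, s u != u & C = orbit_arcs s (porbit s u)) (C \in orbit_config s).
Proof.
apply: (iffP imsetP) => [[P]|[u su ->]].
  rewrite inE => /andP[/imsetP[u _ ->] c] ->; exists u => //.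
  by rewrite -porbit_fixed.
by exists (porbit s u); rewrite // inE mem_porbits porbit_fixed.
Qed.

Lemma mem_orbit_arcs s P u v : ((u, v) \in orbit_arcs s P) = (u \in P) && (v == s u).
Proof.
apply/imsetP/andP => [[w wP [-> ->]]|[uP /eqP ->]]; first by rewrite wP eqxx.
by exists u.
Qed.

(** The only arc leaving a moved vertex [u] ends at [s u], so the arcs determine [s] where it moves
    something, and it is the identity elsewhere. *)
Lemma orbit_config_inj : injective orbit_config.
Proof.
suff H s t : orbit_config s = orbit_config t -> forall u, s u != u -> t u = s u.
  move=> s t E; apply/permP => u; have [su|su] := eqVneq (s u) u.
    have [tu|tu] := eqVneq (t u) u; first by rewrite su tu.
    by rewrite -(H t s _ u tu).
  by rewrite (H s t _ u su).
move=> E u su.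
have : orbit_arcs s (porbit s u) \in orbit_config t.
  by rewrite -E; apply/orbit_configP; exists u.
case/orbit_configP => v _ /setP/(_ (u, s u)).
rewrite !mem_orbit_arcs porbit_id eqxx /= => /esym /andP[_ /eqP ->] //.
Qed.

Definition adj_perm s := [forall u, (s u != u) ==> adj u (s u)].

Lemma next_orbit s u v : v \in porbit s u ->
  next (traject s u #|porbit s u|) v = s v.
Proof.
rewrite porbit_traject => hv; apply/esym/eqP.
apply: (next_cycle (e := frel s)) hv.
case: #|porbit s u| (iter_porbit s u) => // n /=.
by rewrite rcons_path fpath_traject last_traject /= => ->.
Qed.

Lemma orbit_config_is_config s :
  ~~ has_odd_orbit s -> adj_perm s -> is_config adj (orbit_config s).
Proof.
move=> /existsPn ev /forallP ad; split.
  move=> C /orbit_configP[u su ->]; exists (traject s u #|porbit s u|); split.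
  - by rewrite size_traject lt0n card_porbit_neq0.
  - rewrite size_traject; have := ev u; rewrite /odd_orbit porbit_fixed su andbT //.
  - apply/andP; split; last exact: uniq_traject_porbit.
    apply: (cycle_from_next (uniq_traject_porbit s u)) => v.
    rewrite -porbit_traject => hv; rewrite next_orbit //.
    apply: (implyP (ad v)); apply: (porbits_moved (mem_porbits s u)) => //.
    by rewrite porbit_fixed.
  - apply/setP => -[v w]; rewrite mem_orbit_arcs; apply/andP/imsetP.
      move=> [hv /eqP ->]; exists v; first by rewrite -porbit_traject.
      by rewrite next_orbit.
    by move=> [x hx [-> ->]]; rewrite porbit_traject hx next_orbit // porbit_traject.
move=> C D /orbit_configP[u su ->] /orbit_configP[v sv ->].
rewrite (inj_eq (@orbit_arcs_inj s)) !support_orbit_arcs => ne.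
apply/pred0P => w /=; apply: contraNF ne => /andP[].
by rewrite -!eq_porbit_mem => /eqP <- /eqP <-.
Qed.

(** * From a configuration back to a permutation *)

Section PermOfConfig.
Variable S : {set {set V * V}}.
Hypothesis hS : is_config adj S.

Lemma config_loop C u : C \in S -> u \in Defs.support C ->
  exists2 c, [/\ uniq c, ~~ odd (size c), path.cycle adj c & u \in c]
   & C = arcs c /\ Defs.support C =i c.
Proof.
move=> CS; case: hS => /(_ C CS)[c [h0 ho /andP[hc hu] ->]] _ uC.
have sE : Defs.support (arcs c) =i c.
  move=> v; apply/imsetP/idP => [[b /imsetP[w hw ->] ->] //|hv].
  by exists (v, next c v) => //; apply: imset_f.
by exists c; split => //; rewrite -sE.
Qed.

Lemma config_unique C D u : C \in S -> D \in S ->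
  u \in Defs.support C -> u \in Defs.support D -> C = D.
Proof.
move=> CS DS uC uD; apply/eqP; apply: contraT => ne.
have /pred0P/(_ u) /= := (proj2 hS) C D CS DS ne.
by rewrite uC uD.
Qed.

(** In a configuration at most one arc leaves [u], so the choice made by [pick] is forced. Isolated
    vertices become fixed points. *)
Definition config_succ u :=
  if [pick b | (b.1 == u) && [exists C in S, b \in C]] is Some b then b.2 else u.

Lemma config_succE C c u : C \in S -> C = arcs c -> u \in c -> uniq c ->
  config_succ u = next c u.
Proof.
move=> CS Cc uc hc; rewrite /config_succ; case: pickP => [[v w] /= /andP[/eqP ->]|].
  case/existsP => D /andP[DS hD].
  have uC : u \in Defs.support C.
    by rewrite Cc; apply/imsetP; exists (u, next c u) => //; apply: imset_f.
  have uD : u \in Defs.support D by apply/imsetP; exists (u, w).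
  move: hD; rewrite (config_unique DS CS uD uC) Cc => /imsetP[z _ [-> ->]] //.
move/(_ (u, next c u)); rewrite /= eqxx /= => /existsPn /(_ C).
by rewrite CS Cc imset_f.
Qed.

Lemma config_succ_id u : u \notin \bigcup_(C in S) Defs.support C -> config_succ u = u.
Proof.
move=> hu; rewrite /config_succ; case: pickP => // b /andP[/eqP bu].
case/existsP => C /andP[CS bC]; case/negP: hu; apply/bigcupP; exists C => //.
by apply/imsetP; exists b.
Qed.

Lemma config_succ_support C u : C \in S -> u \in Defs.support C -> config_succ u \in Defs.support C.
Proof.
move=> CS uC; have [c [hu _ _ uc] [Cc sc]] := config_loop CS uC.
by rewrite (config_succE CS Cc uc hu) sc mem_next.
Qed.

(** The successor of a vertex stays in the same loop, or is the vertex itself if isolated. Two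
    vertices with a common successor thus lie in one loop, where [prev] inverts [next]. *)
Lemma config_succ_inj : injective config_succ.
Proof.
move=> u v E.
have [/bigcupP[C CS uC]|uN] := boolP (u \in \bigcup_(C in S) Defs.support C); last first.
  have [/bigcupP[D DS vD]|vN] := boolP (v \in \bigcup_(C in S) Defs.support C); last first.
    by rewrite -(config_succ_id uN) E config_succ_id.
  case/negP: (uN); apply/bigcupP; exists D => //.
  by rewrite -(config_succ_id uN) E config_succ_support.
have [/bigcupP[D DS vD]|vN] := boolP (v \in \bigcup_(C in S) Defs.support C); last first.
  case/negP: (vN); apply/bigcupP; exists C => //.
  by rewrite -(config_succ_id vN) -E config_succ_support.
have DC : D = C.
  apply: (config_unique (u := config_succ u)) => //; last exact: config_succ_support.
  by rewrite E config_succ_support.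
rewrite {}DC {D DS} in vD.
have [c [hu _ _ uc] [Cc sc]] := config_loop CS uC.
rewrite sc in vD.
move: E; rewrite (config_succE CS Cc uc hu) (config_succE CS Cc vD hu) => E.
by rewrite -(prev_next hu u) E prev_next.
Qed.

Definition config_perm := perm config_succ_inj.

Lemma config_permE C c u : C \in S -> C = arcs c -> u \in c -> uniq c ->
  config_perm u = next c u.
Proof. by move=> CS Cc uc hu; rewrite permE (config_succE CS Cc uc hu). Qed.

Lemma config_perm_orbit C c u : C \in S -> C = arcs c -> u \in c -> uniq c ->
  porbit config_perm u =i c.
Proof.
move=> CS Cc uc hu v; apply/porbitP/idP => [[i ->]|vc].
  elim: i => [|i IH]; first by rewrite expg0 perm1.
  by rewrite expgSr permM (config_permE CS Cc IH hu) mem_next.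
have fc : fcycle config_perm c.
  by apply: cycle_from_next => // w wc; rewrite /= (config_permE CS Cc wc hu).
have /= := fconnect_cycle fc uc v; rewrite vc => /iter_findex <-.
by exists (findex config_perm u v); rewrite permX.
Qed.

Lemma config_orbit_arcs C c u : C \in S -> C = arcs c -> u \in c -> uniq c ->
  orbit_arcs config_perm (porbit config_perm u) = C.
Proof.
move=> CS Cc uc hu; apply/setP => -[v w].
rewrite mem_orbit_arcs (config_perm_orbit CS Cc uc hu).
rewrite [in RHS]Cc; apply/andP/imsetP.
  move=> [vc /eqP ->]; exists v => //; by rewrite (config_permE CS Cc vc hu).
by case=> z zc [-> ->]; rewrite zc (config_permE CS Cc zc hu).
Qed.

End PermOfConfig.
End OrbitConfig.

Section ConfigSurjective.
Variables (V : finType) (adj : rel V) (S : {set {set V * V}}).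
Hypothesis hS : is_config adj S.

Lemma config_perm_moved u : config_perm hS u != u ->
  exists C c, [/\ C \in S, C = arcs c, u \in c, uniq c & ~~ odd (size c) /\ path.cycle adj c].
Proof.
move=> mu; have [/bigcupP[C CS uC]|uN] := boolP (u \in \bigcup_(C in S) Defs.support C).
  have [c [hu ho hc uc] [Cc sc]] := config_loop hS CS uC.
  by exists C, c.
by case/negP: mu; rewrite permE config_succ_id.
Qed.

Lemma orbit_config_perm : orbit_config (config_perm hS) = S.
Proof.
apply/setP => C; apply/orbit_configP/idP => [[u mu ->]|CS].
  have [D [c [DS Dc uc hu _]]] := config_perm_moved mu.
  by rewrite (config_orbit_arcs hS DS Dc uc hu).
have [c [h0 ho /andP[hc hu] Cc]] := proj1 hS C CS.
(* Even length excludes a single vertex, so the first vertex of the loop is moved to a different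
   one. *)
case: c => [//|u [|v c]] // in h0 ho hc hu Cc *.
exists u; last by rewrite (config_orbit_arcs hS CS Cc) // mem_head.
rewrite (config_permE hS CS Cc) ?mem_head //= eqxx.
by move: hu; rewrite /= inE negb_or eq_sym => /andP[/andP[]].
Qed.

Lemma config_perm_even : ~~ has_odd_orbit (config_perm hS).
Proof.
apply/existsPn => u; rewrite /odd_orbit porbit_fixed.
have [mu|] := boolP (config_perm hS u != u); last by rewrite andbF.
have [D [c [DS Dc uc hu [ho _]]]] := config_perm_moved mu.
by rewrite (eq_card (config_perm_orbit hS DS Dc uc hu)) (card_uniqP hu) (negbTE ho).
Qed.

Lemma config_perm_adj : adj_perm adj (config_perm hS).
Proof.
apply/forallP => u; apply/implyP => mu.
have [D [c [DS Dc uc hu [_ hc]]]] := config_perm_moved mu.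
by rewrite (config_permE hS DS Dc uc hu); exact: next_cycle.
Qed.

End ConfigSurjective.

(** * The partition function as a determinant *)

Section PartitionDeterminant.
Variables (R : numDomainType) (V : finType) (adj O : rel V).
Variables (x : V -> R) (a : V -> V -> R).
Hypothesis adj_sym : symmetric adj.
Hypothesis O_adj : forall u v, O u v -> adj u v.
Hypothesis O_asym : forall u v, O u v -> ~~ O v u.
Hypothesis a_sym : forall u v, a u v = a v u.

Definition signed_adjacency u v : R := if u == v then x u else sgn R O u v * a u v.

Lemma sgn_skew u v : sgn R O v u = - sgn R O u v.
Proof.
rewrite /sgn; case vu: (O v u); case uv: (O u v); rewrite ?opprK ?oppr0 //.
by move: (O_asym uv); rewrite vu.
Qed.

Lemma signed_adjacency_skew u v :
  u != v -> signed_adjacency v u = - signed_adjacency u v.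
Proof.
move=> uv; rewrite /signed_adjacency (negbTE uv) eq_sym (negbTE uv).
by rewrite sgn_skew a_sym mulNr.
Qed.

Lemma config_weight_orbits (s : {perm V}) : ~~ has_odd_orbit s ->
  config_weight O x a (orbit_config s) = perm_term signed_adjacency s.
Proof.
move=> ev; rewrite (perm_term_even _ ev) /config_weight; congr (_ * _).
  rewrite big_imset /=; last by move=> P Q _ _; exact: orbit_arcs_inj.
  apply: eq_big => [P|P]; first by rewrite inE.
  rewrite inE => /andP[PP c]; rewrite /loop_weight; congr (- _).
  rewrite big_imset /=; last by move=> u v _ _ [].
  apply: eq_bigr => v vP; rewrite /signed_adjacency eq_sym.
  by rewrite (negbTE (porbits_moved PP c vP)).
apply: eq_big => [v|v _]; last by rewrite /signed_adjacency eqxx.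
rewrite -[RHS]negbK; congr (~~ _); apply/bigcupP/idP.
  move=> [C /orbit_configP[u su ->]]; rewrite support_orbit_arcs => vu.
  by apply: (porbits_moved (mem_porbits s u)) vu; rewrite porbit_fixed.
move=> sv; exists (orbit_arcs s (porbit s v)).
  by apply/orbit_configP; exists v.
by rewrite support_orbit_arcs porbit_id.
Qed.

Lemma partition_function_perm :
  partition_function adj O x a = \sum_(s : {perm V}) perm_term signed_adjacency s.
Proof.
rewrite (sum_even_orbits signed_adjacency_skew) (bigID (adj_perm adj)) /=.
(* A permutation that moves some vertex to a non-neighbour contributes 0, the value of [sgn] off the
   edges. *)
rewrite [X in _ + X]big1 ?addr0; last first.
  move=> s /andP[_ /forallPn[u]]; rewrite negb_imply => /andP[su nadj].
  rewrite /perm_term (bigD1 u) //= /signed_adjacency eq_sym (negbTE su) /sgn.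
  case: ifP => [/O_adj|_]; first by rewrite (negbTE nadj).
  case: ifP => [/O_adj|_]; first by rewrite adj_sym (negbTE nadj).
  by rewrite !mul0r mulr0.
rewrite /partition_function.
(* The configurations are exactly the images of the remaining permutations under the injective
   [orbit_config]. *)
transitivity (\sum_(S in @orbit_config V @: [set s | ~~ has_odd_orbit s & adj_perm adj s])
   config_weight O x a S).
  apply: eq_bigl => S; apply/asboolP/imsetP => [hS|[s]].
    exists (config_perm hS); rewrite ?orbit_config_perm // inE.
    by rewrite config_perm_even config_perm_adj.
  by rewrite inE => /andP[? ?] ->; exact: orbit_config_is_config.
rewrite big_imset /=; last by move=> s t _ _; exact: orbit_config_inj.
apply: eq_big => s; first by rewrite inE.
by rewrite inE => /andP[ev _]; exact: config_weight_orbits.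
Qed.

End PartitionDeterminant.

(** * Matrices indexed by a finite type *)

Section FinTypeMatrix.
Variables (R : comNzRingType) (V : finType).
Implicit Type (K : V -> V -> R).

Definition fun_mx K : 'M[R]_#|V| := \matrix_(i, j) K (enum_val i) (enum_val j).

Fact enum_perm_inj (s : 'S_#|V|) : injective (fun u : V => enum_val (s (enum_rank u))).
Proof. by move=> u v /enum_val_inj/perm_inj/enum_rank_inj. Qed.

(** Transport along the enumeration of [V], which turns the Leibniz sum over index permutations into
    a sum over [{perm V}]. *)
Definition enum_perm (s : 'S_#|V|) : {perm V} := perm (@enum_perm_inj s).

Lemma enum_permM s t : enum_perm (s * t) = (enum_perm s * enum_perm t)%g.
Proof. by apply/permP => u; rewrite permM !permE /= enum_valK. Qed.

Lemma enum_perm_tperm i j : enum_perm (tperm i j) = tperm (enum_val i) (enum_val j).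
Proof.
apply/permP => u; rewrite permE -[u in RHS]enum_rankK.
by rewrite (inj_tperm _ _ _ enum_val_inj).
Qed.

(** The transport is multiplicative and takes transpositions to transpositions. *)
Lemma odd_enum_perm s : enum_perm s = s :> bool.
Proof.
have [ts -> _] := prod_tpermP s; elim: ts => [|t ts IH].
  rewrite !big_nil odd_perm1.
  suff -> : enum_perm 1 = 1%g by rewrite odd_perm1.
  by apply/permP => u; rewrite permE !perm1 enum_rankK.
rewrite big_cons enum_permM !odd_permM IH enum_perm_tperm !odd_tperm.
by rewrite (inj_eq enum_val_inj).
Qed.

Lemma enum_perm_bij : bijective enum_perm.
Proof.
apply: inj_card_bij => [s t E|].
  apply/permP => i; apply: enum_val_inj.
  by have /permP/(_ (enum_val i)) := E; rewrite !permE enum_valK.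
have E (T : finType) : #|{perm T}| = (#|T|)`!%N.
  rewrite -(finset.cardsT T) -card_perm; apply: eq_card => s; apply/esym.
  by apply/fintype.subsetP => u; rewrite !inE.
by rewrite !E card_ord.
Qed.

Lemma det_fun_mx K :
  \det (fun_mx K) = \sum_(s : {perm V}) (-1) ^+ s * \prod_u K u (s u).
Proof.
rewrite (reindex enum_perm); last exact/onW_bij/enum_perm_bij.
apply: eq_bigr => s _; rewrite odd_enum_perm; congr (_ * _).
rewrite (reindex enum_rank); last exact/onW_bij/enum_rank_bij.
by apply: eq_bigr => u _; rewrite mxE enum_rankK permE.
Qed.

Lemma mul_fun_mx (K L : V -> V -> R) :
  fun_mx K *m fun_mx L = fun_mx (fun u v => \sum_w K u w * L w v).
Proof.
apply/matrixP => i j; rewrite !mxE [RHS](reindex (@enum_val V V)) /=.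
  by apply: eq_bigr => k _; rewrite !mxE.
exact/onW_bij/enum_val_bij.
Qed.

Lemma eq_fun_mx (K L : V -> V -> R) :
  (forall u v, K u v = L u v) -> fun_mx K = fun_mx L.
Proof. by move=> E; apply/matrixP => i j; rewrite !mxE E. Qed.

End FinTypeMatrix.

(** * Kronecker products indexed by dependent functions *)

(** Dependent functions are traded for functions into the tagged sum of the types [T i], where
    nondependent distributivity applies. *)
Lemma bigA_distr_dffun (R : comNzRingType) (I : finType) (T : I -> finType)
    (F : forall i, T i -> R) :
  \prod_i \sum_(j : T i) F i j = \sum_(f : {dffun forall i, T i}) \prod_i F i (f i).
Proof.
rewrite (reindex (@dffun_of_fprod I T)); last exact/onW_bij/dffun_of_fprod_bij.
transitivity (\sum_(t : fprod T) \prod_(i in I) [ffun j => F i j] (t i)).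
  rewrite (@big_fprod _ _ _ _ _ _ _ (fun i => [ffun j => F i j])).
  under eq_bigr do rewrite (big_tag (fun i (j : T i) => F i j)).
  rewrite bigA_distr_big_dep.
  apply: eq_big => f; first by [].
  move=> _; apply: eq_bigr => i _; congr untag.
  by apply/funext => j; rewrite ffunE.
by apply: eq_bigr => t _; apply: eq_bigr => i _; rewrite !ffunE.
Qed.

Section TensorProduct.
Variables (R : comNzRingType) (I : finType) (n : I -> nat).
Let V := {dffun forall i, 'I_(n i)}.
Implicit Types M N : forall i, 'M[R]_(n i).

Definition tensor M : 'M[R]_#|V| := fun_mx (fun u v : V => \prod_i M i (u i) (v i)).

(** The mixed-product rule: a product of matrix-product entries expands into a sum over intermediate
    vertices. *)
Lemma tensor_mul M N : tensor M *m tensor N = tensor (fun i => M i *m N i).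
Proof.
rewrite /tensor mul_fun_mx; apply: eq_fun_mx => u v.
under [RHS]eq_bigr do rewrite mxE.
rewrite bigA_distr_dffun; apply: eq_bigr => w _.
by rewrite big_split.
Qed.

Lemma tensor1 : tensor (fun i => 1%:M) = 1%:M.
Proof.
apply/matrixP => i j; rewrite !mxE -(inj_eq enum_val_inj).
set u := enum_val i; set v := enum_val j.
have [->|/eqP uv] := eqVneq u v; first by apply: big1 => k _; rewrite mxE eqxx.
have /forallPn[k uvk] : ~~ [forall k, u k == v k].
  by apply/negP => /forallP E; apply: uv; apply/ffunP => k; exact/eqP.
by rewrite (bigD1 k) //= mxE (negbTE uvk) mul0r.
Qed.

Lemma eq_tensor M N : (forall i, M i = N i) -> tensor M = tensor N.
Proof. by move=> E; apply: eq_fun_mx => u v; apply: eq_bigr => i _; rewrite E. Qed.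

Lemma tensor_opp (s : I) M N : M s = - N s -> (forall i, i != s -> M i = N i) ->
  tensor M = - tensor N.
Proof.
move=> Es E; apply/matrixP => i j; rewrite !mxE (bigD1 s) //= [in RHS](bigD1 s) //=.
rewrite Es mxE mulNr; congr (- (_ * _)).
by apply: eq_bigr => k ks; rewrite E.
Qed.

End TensorProduct.

Lemma tensor_unit (R : comUnitRingType) (I : finType) (n : I -> nat)
    (M : forall i, 'M[R]_(n i)) : (forall i, M i \in unitmx) -> tensor M \in unitmx.
Proof.
move=> hM; have : tensor M *m tensor (fun i => invmx (M i)) = 1%:M.
  rewrite tensor_mul -tensor1; apply: eq_tensor => i; exact: mulmxV.
by case/mulmx1_unit.
Qed.

(** * The antiperiodic difference on a cycle and its spectrum *)

Section TwistedCycle.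
Variables (R : realType) (n : nat).

(* For n = 2, where C_2 has two parallel edges, the entries are 2 and -2. *)
Definition twisted_diff : 'M[R]_n :=
  \matrix_(i, j) (if (i < j)%N then (cycle_mult i j)%:R
                  else if (j < i)%N then - (cycle_mult i j)%:R else 0).

Definition parity_mx : 'M[R]_n := \matrix_(i, j) ((-1) ^+ i *+ (i == j)).

Lemma mul_parity (M : 'M[R]_n) : parity_mx *m M = \matrix_(i, j) ((-1) ^+ i * M i j).
Proof.
apply/matrixP => i j; rewrite !mxE (bigD1 i) //= big1 ?addr0 ?mxE ?eqxx // => k ki.
by rewrite mxE eq_sym (negbTE ki) mul0r.
Qed.

Lemma mulmx_parity (M : 'M[R]_n) : M *m parity_mx = \matrix_(i, j) ((-1) ^+ j * M i j).
Proof.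
apply/matrixP => i j; rewrite !mxE (bigD1 j) //= big1 ?addr0 ?mxE ?eqxx => [|k kj].
  by rewrite mulrC.
by rewrite mxE (negbTE kj) mulr0.
Qed.

Lemma parity_mxK : parity_mx *m parity_mx = 1%:M.
Proof.
rewrite mul_parity; apply/matrixP => i j; rewrite !mxE mulrnAr -expr2.
by rewrite sqrr_sign.
Qed.

(** An even cycle is bipartite: an entry vanishes unless [i + j] is odd, and then the signs
    [(-1) ^+ i] and [(-1) ^+ j] are opposite. *)
Lemma twisted_diff_parity : ~~ odd n ->
  twisted_diff *m parity_mx = - (parity_mx *m twisted_diff).
Proof.
move=> en; rewrite mul_parity mulmx_parity; apply/matrixP => i j.
rewrite !mxE; have [oij|eij] := boolP (odd (i + j)).
  have -> : (-1) ^+ j = - (-1) ^+ i :> R.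
    rewrite -signr_odd -[in RHS]signr_odd -signrN; congr (_ ^+ _).
    by move: oij; rewrite oddD; do 2!case: odd.
  by rewrite mulNr.
suff -> : cycle_mult i j = 0 by rewrite oppr0 !if_same !mulr0 oppr0.
rewrite /cycle_mult; have := ltn_ord i; have := ltn_ord j; lia.
Qed.

(** The wrap-around entries have the opposite sign to the neighbouring ones. This matches
    antiperiodicity: -g(0) = g(n) and g(n-1) = -g(-1). *)
Lemma twisted_diff_mul (g : R -> R) (i : 'I_n) : (1 < n)%N ->
  (forall t, g (t + n%:R) = - g t) ->
  \sum_j twisted_diff i j * g j%:R = g (i%:R + 1) - g (i%:R - 1).
Proof.
move=> n1 gn.
(* Neighbours and wrap-around are separate indicator terms because they coincide for n = 2. The
   guard [0 < i] is there because [0.-1] is 0. *)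
have E (j : 'I_n) : twisted_diff i j * g j%:R =
   ((if j == i.+1 :> nat then g j%:R else 0)
    - (if j == 0 :> nat then if i.+1 == n then g j%:R else 0 else 0))
   - ((if j == i.-1 :> nat then if (0 < i)%N then g j%:R else 0 else 0)
    - (if j == n.-1 :> nat then if i == 0 :> nat then g j%:R else 0 else 0)).
  have hi := ltn_ord i; have hj := ltn_ord j.
  rewrite mxE /cycle_mult; case: (ltngtP i j) => h.
  - have -> : (i.+1 == j) || (j.+1 == i) = (j == i.+1 :> nat) by lia.
    have -> : (i == 0 :> nat) && (j.+1 == n) || (j == 0 :> nat) && (i.+1 == n) =
      (j == n.-1 :> nat) && (i == 0 :> nat) by lia.
    have -> : (j == 0 :> nat) = false by lia.
    have -> : (j == i.-1 :> nat) = false by lia.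
    by case: (j == i.+1 :> nat); case: (j == n.-1 :> nat); case: (i == 0 :> nat); rewrite /=; ring.
  - have -> : (i.+1 == j) || (j.+1 == i) = (j == i.-1 :> nat) && (0 < i)%N by lia.
    have -> : (i == 0 :> nat) && (j.+1 == n) || (j == 0 :> nat) && (i.+1 == n) =
      (j == 0 :> nat) && (i.+1 == n) by lia.
    have -> : (j == i.+1 :> nat) = false by lia.
    have -> : (i == 0 :> nat) = false by lia.
    rewrite if_same.
    by case: (j == i.-1 :> nat); case: (j == 0 :> nat);
      case: (0 < i)%N; case: (i.+1 == n); rewrite /=; ring.
  - have -> : (j == i.+1 :> nat) = false by lia.
    have -> : (if j == 0 :> nat then if i.+1 == n then g j%:R else 0 else 0) = 0.
      by case: eqP => // ?; case: eqP => // ?; lia.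
    have -> : (if j == i.-1 :> nat then if (0 < i)%N then g j%:R else 0 else 0) = 0.
      by case: eqP => // ?; case: ltnP => // ?; lia.
    have -> : (if j == n.-1 :> nat then if i == 0 :> nat then g j%:R else 0 else 0) = 0.
      by case: eqP => // ?; case: eqP => // ?; lia.
    by rewrite !subr0 mul0r.
rewrite (eq_bigr _ (fun j _ => E j)) !sumrB -!big_mkcond /=.
rewrite (big_ord1_eq _ (fun j => g j%:R)).
rewrite (big_ord1_eq _ (fun j => if i.+1 == n then g j%:R else 0)).
rewrite (big_ord1_eq _ (fun j => if (0 < i)%N then g j%:R else 0)).
rewrite (big_ord1_eq _ (fun j => if i == 0 :> nat then g j%:R else 0)).
have -> : (0 < n)%N by lia.
have -> : (n.-1 < n)%N by lia.
have -> : (i.-1 < n)%N by have := ltn_ord i; lia.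
congr (_ - _).
  have [hi|hi] := eqVneq i.+1 n.
    by rewrite natr1 hi ltnn sub0r -gn add0r.
  have -> : (i.+1 < n)%N by have := ltn_ord i; lia.
  by rewrite subr0 -natr1.
have [->|hi] := posnP i.
  have -> : n.-1%:R = (0 - 1) + n%:R :> R.
    by rewrite -[in RHS](ltn_predK n1) -natr1; ring.
  by rewrite gn /= sub0r opprK mulr0n.
by rewrite subr0 -[in RHS](ltn_predK hi) -natr1 addrK.
Qed.

End TwistedCycle.

(** * Trigonometric sums and the antiperiodic Hartley basis *)

Section TrigonometricSums.
Variable R : realType.
Implicit Types (t b : R) (k n : nat).

Lemma sin_add_natpi t k : sin (t + k%:R * pi) = (-1) ^+ k * sin t.
Proof.
elim: k => [|k IH]; first by rewrite mul0r addr0 expr0 mul1r.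
by rewrite -natr1 mulrDl mul1r addrA sinDpi IH exprS mulN1r mulNr.
Qed.

Lemma cos_add_natpi t k : cos (t + k%:R * pi) = (-1) ^+ k * cos t.
Proof.
elim: k => [|k IH]; first by rewrite mul0r addr0 expr0 mul1r.
by rewrite -natr1 mulrDl mul1r addrA cosDpi IH exprS mulN1r mulNr.
Qed.

Lemma sin_natmul0 b k : sin b = 0 -> sin (k%:R * b) = 0.
Proof.
move=> sb; elim: k => [|k IH]; first by rewrite mul0r sin0.
by rewrite -natr1 mulrDl mul1r sinD IH sb mul0r mulr0 addr0.
Qed.

(** The product-to-sum formula writes each term as a difference of sines at consecutive even
    multiples of [b], and the sum telescopes. *)
Lemma sum_cos_odd n b :
  2 * sin b * (\sum_(j < n) cos ((2 * j.+1%:R - 1) * b)) = sin (2 * n%:R * b).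
Proof.
rewrite mulr_sumr -(big_mkord xpredT (fun j => 2 * sin b * cos ((2 * j.+1%:R - 1) * b))).
rewrite (eq_bigr (fun j => sin (2 * j.+1%:R * b) - sin (2 * j%:R * b))) => [|j _].
  by rewrite (telescope_sumr (fun j => sin (2 * j%:R * b))) // mulr0 mul0r sin0 subr0.
have -> : 2 * j.+1%:R * b = (2 * j.+1%:R - 1) * b + b by ring.
have -> : 2 * j%:R * b = (2 * j.+1%:R - 1) * b - b by rewrite -natr1; ring.
by rewrite sinD sinB; ring.
Qed.

Lemma sum_sin_odd n b :
  2 * sin b * (\sum_(j < n) sin ((2 * j.+1%:R - 1) * b)) = 1 - cos (2 * n%:R * b).
Proof.
rewrite mulr_sumr -(big_mkord xpredT (fun j => 2 * sin b * sin ((2 * j.+1%:R - 1) * b))).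
rewrite (eq_bigr (fun j => - cos (2 * j.+1%:R * b) - - cos (2 * j%:R * b))) => [|j _].
  by rewrite (telescope_sumr (fun j => - cos (2 * j%:R * b))) // mulr0 mul0r cos0; ring.
have -> : 2 * j.+1%:R * b = (2 * j.+1%:R - 1) * b + b by ring.
have -> : 2 * j%:R * b = (2 * j.+1%:R - 1) * b - b by rewrite -natr1; ring.
by rewrite cosD cosB; ring.
Qed.

(** For k < i the argument lies strictly between 0 and pi; the other order follows by oddness of the
    sine. *)
Lemma sin_quotient_neq0 n (i k : 'I_n) : i != k ->
  sin (pi / n%:R * (i%:R - k%:R)) != 0 :> R.
Proof.
wlog ik : i k / (k < i)%N => [H|_].
  move=> ne; have [/H|/H|/val_inj e] := ltngtP k i; first exact.
    by rewrite eq_sym -opprB mulrN sinN oppr_eq0; apply.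
  by rewrite e eqxx in ne.
apply: lt0r_neq0; apply: sin_gt0_pi.
have n0 : 0 < n%:R :> R by rewrite ltr0n (leq_ltn_trans (leq0n _) (ltn_ord i)).
have p0 := pi_gt0 R; rewrite -natrB; last exact: ltnW.
rewrite mulr_gt0 /= ?divr_gt0 // ?ltr0n ?subn_gt0 //.
rewrite mulrAC ltr_pdivrMr // ltr_pM2l // ltr_nat.
by rewrite (leq_ltn_trans (leq_subr _ _)).
Qed.

Definition angle n j : R := (2 * j.+1%:R - 1) * pi / n%:R.
(** This is the Hartley kernel; [cas'] is its derivative. *)
Definition cas t : R := cos t + sin t.
Definition cas' t : R := cos t - sin t.

Lemma natr_odd_pi j : (2 * j.+1%:R - 1) * pi = (2 * j + 1)%:R * pi :> R.
Proof. by rewrite natrD natrM -natr1; ring. Qed.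

(** A full turn adds an odd multiple of pi, which is the source of antiperiodicity. *)
Lemma angle_period n j t : (0 < n)%N ->
  angle n j * (t + n%:R) = angle n j * t + (2 * j + 1)%:R * pi.
Proof.
move=> n0; rewrite mulrDr /angle divfK ?pnatr_eq0 -?lt0n // natr_odd_pi //.
Qed.

Lemma cas_antiperiodic n j t : (0 < n)%N ->
  cas (angle n j * (t + n%:R)) = - cas (angle n j * t).
Proof.
move=> n0; rewrite /cas angle_period // cos_add_natpi sin_add_natpi.
by rewrite -signr_odd addn1 /= mul2n odd_double /=; ring.
Qed.

Lemma cas'_antiperiodic n j t : (0 < n)%N ->
  cas' (angle n j * (t + n%:R)) = - cas' (angle n j * t).
Proof.
move=> n0; rewrite /cas' angle_period // cos_add_natpi sin_add_natpi.
by rewrite -signr_odd addn1 /= mul2n odd_double /=; ring.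
Qed.

(* A real substitute for the antiperiodic Fourier basis. *)
Definition hartley n : 'M[R]_n := \matrix_(i, j) cas (angle n j * i%:R).

(** The product of two kernel values is the cosine of the difference plus the sine of the sum. The
    sine sums vanish, and the cosine sums vanish off the diagonal. *)
Lemma hartley_orthogonal n : hartley n *m (hartley n)^T = n%:R%:M.
Proof.
apply/matrixP => i k; rewrite !mxE.
pose b : R := pi / n%:R * (i%:R - k%:R); pose c : R := pi / n%:R * (i%:R + k%:R).
have n0 : (0 < n)%N := leq_ltn_trans (leq0n _) (ltn_ord i).
have nR : n%:R != 0 :> R by rewrite pnatr_eq0 -lt0n.
have E (j : 'I_n) : hartley n i j * (hartley n)^T j k =
    cos ((2 * j.+1%:R - 1) * b) + sin ((2 * j.+1%:R - 1) * c).
  rewrite !mxE /cas.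
  have -> : (2 * j.+1%:R - 1) * b = angle n j * i%:R - angle n j * k%:R.
    by rewrite /b /angle; ring.
  have -> : (2 * j.+1%:R - 1) * c = angle n j * i%:R + angle n j * k%:R.
    by rewrite /c /angle; ring.
  by rewrite cosB sinD; ring.
rewrite (eq_bigr _ (fun j _ => E j)) big_split /= [X in _ + X](_ : _ = 0) ?addr0; last first.
  have [sc|sc] := eqVneq (sin c) 0.
    apply: big1 => j _.
    have -> : 2 * j.+1%:R - 1 = (2 * j + 1)%:R :> R by rewrite natrD natrM -natr1; ring.
    exact: sin_natmul0.
  (* Here 2nc is an even multiple of pi, so the telescoped value [1 - cos (2 * n%:R * c)] is 0. *)
  apply: (mulfI (x := 2 * sin c)); first by rewrite mulf_neq0 // pnatr_eq0.
  rewrite sum_sin_odd mulr0.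
  have -> : 2 * n%:R * c = 0 + (2 * (i + k))%:R * pi.
    by rewrite natrM natrD /c; field.
  by rewrite cos_add_natpi cos0 -signr_odd mul2n odd_double; ring.
have [ik|ik] := eqVneq i k.
  rewrite (eq_bigr (fun=> 1)) => [|j _]; last by rewrite /b ik subrr !mulr0 cos0.
  by rewrite sumr_const card_ord.
apply: (mulfI (x := 2 * sin b)).
  by rewrite mulf_neq0 // ?pnatr_eq0 // sin_quotient_neq0.
rewrite sum_cos_odd mulr0.
have -> : 2 * n%:R * b = (2 * i)%:R * pi - (2 * k)%:R * pi.
  by rewrite !natrM /b; field.
by rewrite sinB !sin_natmul0 ?sinpi // mul0r mulr0 subr0.
Qed.

Lemma hartley_unit n : hartley n \in unitmx.
Proof.
case: n => [|n]; first by rewrite unitmxE det_mx00 unitr1.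
have : hartley n.+1 *m (n.+1%:R^-1 *: (hartley n.+1)^T) = 1%:M.
  by rewrite -scalemxAr hartley_orthogonal scale_scalar_mx mulVf // pnatr_eq0.
by case/mulmx1_unit.
Qed.

End TrigonometricSums.

Section TwistedCycleSpectrum.
Variables (R : realType) (n : nat).
Hypothesis n1 : (1 < n)%N.

(** Differences take [cas] to [cas'] with factor 2 sin, and [cas'] back to [cas] with factor -2 sin,
    so the square of the operator is diagonal in this basis. *)
Lemma twisted_diff_hartley : twisted_diff R n *m hartley R n =
  \matrix_(i, j) (2 * sin (angle R n j) * cas' (angle R n j * i%:R)).
Proof.
apply/matrixP => i j; rewrite !mxE.
under eq_bigr => k _ do rewrite [hartley _ _ _ _]mxE.
rewrite (twisted_diff_mul (g := fun t => cas (angle R n j * t))) //; last first.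
  by move=> t; apply: cas_antiperiodic; apply: ltnW.
rewrite /cas /cas' [_ * (_ + 1)]mulrDr [_ * (i%:R - 1)]mulrBr mulr1.
move: (angle _ _ _) => b; move: (b * _) => c.
by rewrite (cosD c b) (cosB c b) (sinD c b) (sinB c b); ring.
Qed.

Lemma twisted_diff2_hartley : twisted_diff R n *m (twisted_diff R n *m hartley R n) =
  \matrix_(i, j) (- (4 * sin (angle R n j) ^+ 2) * hartley R n i j).
Proof.
rewrite twisted_diff_hartley; apply/matrixP => i j; rewrite !mxE.
under eq_bigr => k _ do rewrite [X in _ * X]mxE mulrCA.
rewrite -mulr_sumr (twisted_diff_mul (g := fun t => cas' (angle R n j * t))) //; last first.
  by move=> t; apply: cas'_antiperiodic; apply: ltnW.
rewrite /cas /cas' [_ * (_ + 1)]mulrDr [_ * (i%:R - 1)]mulrBr mulr1.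
move: (angle _ _ _) => b; move: (b * _) => c.
by rewrite (cosD c b) (cosB c b) (sinD c b) (sinB c b); ring.
Qed.

End TwistedCycleSpectrum.

(** * Anticommuting direction matrices and their joint spectrum *)

Section DirectionMatrices.
Variables (R : realType) (d : nat) (n : 'I_d -> nat).
Hypothesis n1 : forall t, (1 < n t)%N.
Hypothesis n_even : forall t, ~~ odd (n t).
Implicit Types (s t r : 'I_d).

(* The factors (-1)^(u t) for t > s record the reversals of the lower-dimensional
   labelling in the boustrophedon recursion. *)
Definition direction_factor s t : 'M[R]_(n t) :=
  if (t < s)%N then 1%:M else if t == s then twisted_diff R (n t) else parity_mx R (n t).

Definition direction_mx s := tensor (direction_factor s).

Definition hartley_tensor := tensor (fun t => hartley R (n t)).

(** For s < t, component [t] holds a parity matrix against a twisted difference, which anticommute.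
    In every other component the two factors are equal or one is the identity. *)
Lemma direction_anticomm s t : s != t ->
  direction_mx s *m direction_mx t = - (direction_mx t *m direction_mx s).
Proof.
wlog st : s t / (s < t)%N => [H|_].
  move=> ne; have [/H|/H|/val_inj e] := ltngtP s t; first exact.
    by rewrite eq_sym => /(_ ne) ->; rewrite opprK.
  by rewrite e eqxx in ne.
rewrite !tensor_mul; apply: (tensor_opp (s := t)) => [|r rt]; rewrite /direction_factor.
  by rewrite ltnn eqxx [(t < s)%N]ltnNge (ltnW st) /= gt_eqF // twisted_diff_parity ?opprK.
have [rs|sr|/val_inj ->] := ltngtP r s.
- by rewrite (ltn_trans rs st).
- rewrite (gt_eqF (_ : (s < r)%O)) // (negbTE rt).
  by case: ifP => _; rewrite ?mul1mx ?mulmx1.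
- by rewrite eqxx st mul1mx mulmx1.
Qed.

(** Parity factors square to 1, so only the squared difference in direction [s] is left. *)
Lemma direction2_hartley s : direction_mx s *m direction_mx s *m hartley_tensor =
  fun_mx (fun u v : {dffun forall t, 'I_(n t)} =>
    - (4 * sin (angle R (n s) (v s)) ^+ 2) * \prod_t hartley R (n t) (u t) (v t)).
Proof.
rewrite -mulmxA /hartley_tensor !tensor_mul; apply: eq_fun_mx => u v.
rewrite (bigD1 s) //= [in RHS](bigD1 s) //= mulrA; congr (_ * _).
  by rewrite /direction_factor ltnn eqxx twisted_diff2_hartley // mxE.
apply: eq_bigr => t ts; rewrite /direction_factor (negbTE ts).
by case: ifP => _; rewrite ?mul1mx // mulmxA parity_mxK mul1mx.
Qed.

Lemma hartley_tensor_unit : hartley_tensor \in unitmx.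
Proof. by apply: tensor_unit => t; exact: hartley_unit. Qed.

Variable a : 'I_d -> R.
Definition kasteleyn_mx := \sum_s a s *: direction_mx s.

Lemma kasteleyn_mx2 : kasteleyn_mx *m kasteleyn_mx =
  \sum_s a s ^+ 2 *: (direction_mx s *m direction_mx s).
Proof.
set A := kasteleyn_mx; set B := RHS.
have E : A *m A = \sum_s \sum_t (a s * a t) *: (direction_mx s *m direction_mx t).
  rewrite /A /kasteleyn_mx mulmx_suml; apply: eq_bigr => s _.
  rewrite mulmx_sumr; apply: eq_bigr => t _.
  by rewrite -scalemxAl -scalemxAr scalerA.
(* Adding the double sum to itself with [s] and [t] exchanged pairs each cross term with its
   negative; the factor 2 is cancelled afterwards. *)
have E2 : A *m A + A *m A = B + B.
  have E' : A *m A = \sum_s \sum_t (a t * a s) *: (direction_mx t *m direction_mx s).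
    by rewrite E exchange_big.
  rewrite {1}E' E -big_split -big_split /=; apply: eq_bigr => s _.
  rewrite -big_split (bigD1 s) //= big1 ?addr0 ?expr2 // => t ts.
  by rewrite direction_anticomm // [a t * _]mulrC scalerN addNr.
apply: (scalerI (a := 2 : R)); first by rewrite pnatr_eq0.
by rewrite !scaler_nat !mulr2n.
Qed.

Lemma kasteleyn_det x :
  \det (x%:M - kasteleyn_mx) * \det (x%:M + kasteleyn_mx) =
  \prod_(v : {dffun forall t, 'I_(n t)})
    (x ^+ 2 + \sum_(s < d) 4 * a s ^+ 2 * sin (angle R (n s) (v s)) ^+ 2).
Proof.
pose lam (v : {dffun forall t, 'I_(n t)}) :=
  x ^+ 2 + \sum_(s < d) 4 * a s ^+ 2 * sin (angle R (n s) (v s)) ^+ 2.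
rewrite -det_mulmx.
pose V : finType := {dffun forall t, 'I_(n t)}.
pose D : 'rV[R]_#|V| := \row_j lam (@enum_val V V j).
set A := kasteleyn_mx.
have -> : (x%:M - A) *m (x%:M + A) = (x ^+ 2)%:M - A *m A.
  rewrite mulmxDr !mulmxBl (scalar_mxC x A) -scalar_mxM expr2.
  by rewrite addrA subrK.
(* Column [v] of [hartley_tensor] is an eigenvector for [lam v]. On taking determinants, that of
   [hartley_tensor] cancels. *)
have E : ((x ^+ 2)%:M - A *m A) *m hartley_tensor =
    hartley_tensor *m diag_mx D.
  rewrite mulmxBl kasteleyn_mx2 mulmx_suml.
  under eq_bigr do rewrite -scalemxAl direction2_hartley.
  apply/matrixP => i j; rewrite mul_mx_diag mul_scalar_mx !mxE summxE /lam.
  rewrite mulrDr mulr_sumr mulrC -sumrN; congr (_ + _); apply: eq_bigr => s _.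
  by rewrite !mxE; ring.
have -> : \det ((x ^+ 2)%:M - A *m A) = \det (diag_mx D).
  have H := congr1 determinant E; rewrite !det_mulmx mulrC in H.
  by apply: mulrI H; rewrite -unitmxE hartley_tensor_unit.
rewrite det_diag [RHS](reindex (@enum_val V V)) /=.
  by apply: eq_bigr => i _; rewrite mxE.
exact/onW_bij/enum_val_bij.
Qed.

End DirectionMatrices.

(** * Determinants of x + A for skew A *)

Section SkewDeterminant.

(** A nonzero difference would have the distinct roots 0, 1, 2, ..., as many as its size, hence more
    than its degree. *)
Lemma horner_inj (R : numDomainType) (p q : {poly R}) :
  (forall x, p.[x] = q.[x]) -> p = q.
Proof.
move=> E; apply/eqP; rewrite -subr_eq0; apply: contraT => nz.
pose rs := [seq i%:R : R | i <- iota 0 (size (p - q)%R)].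
have : (size rs < size (p - q)%R)%N.
  apply: max_poly_roots => //.
    by apply/allP => _ /mapP[i _ ->]; rewrite rootE !hornerE E subrr.
  by rewrite map_inj_uniq ?iota_uniq // => i j /eqP; rewrite eqr_nat => /eqP.
by rewrite size_map size_iota ltnn.
Qed.

Lemma horner_char_poly (R : comNzRingType) n (A : 'M[R]_n) x :
  (char_poly A).[x] = \det (x%:M - A).
Proof.
rewrite /char_poly -horner_evalE -det_map_mx; congr (\det _).
apply/matrixP => i j; rewrite !mxE /= horner_evalE !hornerE.
by case: (i == j); rewrite ?mulr1n ?mulr0n ?hornerE.
Qed.

Lemma det_skew (R : numDomainType) n (A : 'M[R]_n) (I : finType) (c : I -> R) k :
  A^T = - A ->
  (forall x, \det (x%:M - A) * \det (x%:M + A) = \prod_i (x ^+ 2 + c i) ^+ (k * 2)) ->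
  forall x, \det (x%:M + A) = \prod_i (x ^+ 2 + c i) ^+ k.
Proof.
move=> Ask H x.
pose Q : {poly R} := \prod_i ('X^2 + (c i)%:P) ^+ k.
have hQ y : Q.[y] = \prod_i (y ^+ 2 + c i) ^+ k.
  by rewrite horner_prod; apply: eq_bigr => i _; rewrite !hornerE.
have hp y : (char_poly (- A)).[y] = \det (y%:M + A) by rewrite horner_char_poly opprK.
have Qmon : Q \is monic.
  apply: monic_prod => i _; apply: monic_exp; apply/monicP.
  by rewrite lead_coefDl ?lead_coefXn // size_polyXn size_polyC; case: eqP.
have : char_poly (- A) ^+ 2 == Q ^+ 2.
  apply/eqP/horner_inj => y; rewrite !horner_exp hp hQ -prodrXl.
  under [RHS]eq_bigr do rewrite -exprM.
  (* Transposing [y%:M + A] gives [y%:M - A], so the two determinants in [H] are equal. *)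
  by rewrite -H expr2; congr (_ * _); rewrite -det_tr linearD /= Ask tr_scalar_mx.
rewrite eqf_sqr => /orP[/eqP E|/eqP E]; first by rewrite -hp E hQ.
(* The opposite sign would equate the leading coefficients 1 and -1. *)
have := char_poly_monic (- A); rewrite E monicE lead_coefN (monicP Qmon).
by move=> /eqP e; have := lt0r_neq0 (ltr0Sn R 1); rewrite -addn1 natrD -{1}e addNr eqxx.
Qed.

End SkewDeterminant.

(** * The orientation of the torus *)

(** Layer p carries the labels from (p-1)N + 1 to pN. This separates the layers and keeps the
    subtraction in a reversed layer from truncating. *)
Lemma boustrophedon_range d (n v : 'I_d -> nat) :
  (forall i, 0 < v i <= n i)%N -> (0 < boustrophedon n v <= \prod_(i < d) n i)%N.
Proof.
elim: d n v => [|d IH] n v h /=; first by rewrite big_ord0.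
rewrite big_ord_recr /=.
have := IH (fun i => n (widen_ord (leqnSn d) i)) (fun i => v (widen_ord (leqnSn d) i))
  (fun i => h _).
have := h ord_max; move: (boustrophedon _ _) (\prod_(i < d) _)%N => L N.
by move=> h1 h2; case: ifP => _; nia.
Qed.

(** At level [s] the vertex in the lower layer has the smaller label. Each higher coordinate that is
    even, hence has odd predecessor, reverses the order once, and the sum counts these reversals
    modulo 2. *)
Lemma boustrophedon_lt d (n u v : 'I_d -> nat) s :
  (forall i, 0 < u i <= n i)%N -> (forall i, 0 < v i <= n i)%N ->
  (forall t, t != s -> u t = v t) -> (u s < v s)%N ->
  (boustrophedon n u < boustrophedon n v)%N =
    ~~ odd (\sum_(t < d | (s < t)%N) (u t).-1) /\
  (boustrophedon n v < boustrophedon n u)%N =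
    odd (\sum_(t < d | (s < t)%N) (u t).-1).
Proof.
elim: d n u v s => [|d IH] n u v s hu hv uv us /=; first by case: s uv us.
pose w := widen_ord (leqnSn d).
have ru := boustrophedon_range (fun i => hu (w i)).
have rv := boustrophedon_range (fun i => hv (w i)).
have -> : (\sum_(t < d.+1 | (s < t)%N) (u t).-1 =
    \sum_(t < d | (s < t)%N) (u (w t)).-1 + (if (s < d)%N then (u ord_max).-1 else 0))%N.
  by rewrite big_mkcond big_ord_recr /= -big_mkcond.
have [ms|ms] := eqVneq s ord_max.
  have z : (\sum_(t < d | (d < t)%N) (u (w t)).-1 = 0)%N.
    by apply: big_pred0 => t; have := ltn_ord t; lia.
  rewrite ms /= ltnn z /=.
  have := hu ord_max; have := hv ord_max; rewrite ms in us; move: ru rv us.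
  rewrite -/w.
  move: (boustrophedon _ _) (boustrophedon _ _) (\prod_(i < d) _)%N => L L' N.
  by case: ifP => _; case: ifP => _; nia.
have sd : (s < d)%N.
  by have := ltn_ord s; rewrite ltnS leq_eqVlt => /orP[/eqP e|//]; case/eqP: ms; exact: val_inj.
have es : s = w (Ordinal sd) by exact: val_inj.
rewrite sd; have um : u ord_max = v ord_max by apply: uv; rewrite eq_sym.
have [] := IH (fun i => n (w i)) (fun i => u (w i)) (fun i => v (w i)) (Ordinal sd)
  (fun i => hu _) (fun i => hv _).
- by move=> t ts; apply: uv; rewrite es;
  apply: contra ts => /eqP/(congr1 val)/= e; exact/eqP/val_inj.
- by rewrite -es.
have := hv ord_max; rewrite -um.
have := hu ord_max; rewrite oddD; move: ru rv; rewrite -/w.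
move: (boustrophedon _ _) (boustrophedon _ _) (\prod_(i < d) _)%N
  (odd (\sum_(_ < _ | _) _)%N) => L L' N b.
move: (u ord_max) => p; case: p => // p; rewrite /=.
case: (odd p) => /=; case: b; nia.
Qed.

Section TorusMatrix.
Variables (R : realType) (d : nat) (m : 'I_d -> nat).
Variable a : 'I_d -> R.
Implicit Types (u v : torus m) (s : 'I_d).

Lemma cycle_mult_sym n (p q : 'I_n) : cycle_mult p q = cycle_mult q p.
Proof. by rewrite /cycle_mult; congr (nat_of_bool _ + nat_of_bool _)%N; exact: orbC. Qed.

Lemma torus_along_sym s u v : torus_along s u v = torus_along s v u.
Proof.
rewrite /torus_along /along /cycle_adj cycle_mult_sym; congr (_ && _).
by apply: eq_forallb => t; rewrite (eq_sym (u t)).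
Qed.

Lemma torus_adj_sym : symmetric (@torus_adj d m).
Proof. by move=> u v; apply: eq_existsb => s; exact: torus_along_sym. Qed.

Lemma torus_edge_weight_sym u v : torus_edge_weight a u v = torus_edge_weight a v u.
Proof.
apply: eq_big => s; first exact: torus_along_sym.
by rewrite cycle_mult_sym.
Qed.

Lemma torus_orientation_adj u v : torus_orientation u v -> torus_adj u v.
Proof. by case/andP. Qed.

Lemma torus_orientation_asym u v : torus_orientation u v -> ~~ torus_orientation v u.
Proof.
by move=> /andP[_ uv]; rewrite negb_and -leqNgt (ltnW uv) orbT.
Qed.

Lemma torus_sgn s u v : torus_along s u v -> (u s < v s)%N ->
  sgn R (@torus_orientation d m) u v = (-1) ^+ (\sum_(t < d | (s < t)%N) u t).
Proof.
move=> uvs us.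
have uv : torus_adj u v by apply/existsP; exists s.
have [] := @boustrophedon_lt d (fun i => 2 * m i)%N (fun i => (u i).+1) (fun i => (v i).+1) s.
- by move=> i; rewrite ltn_ord.
- by move=> i; rewrite ltn_ord.
- move=> t ts; congr S; case/andP: uvs => /forallP/(_ t).
  by rewrite (negbTE ts) eqbF_neg negbK => /eqP ->.
- by rewrite ltnS.
rewrite /= => lt1 lt2; have vu : torus_adj v u by rewrite torus_adj_sym.
rewrite /sgn /torus_orientation uv vu -signr_odd.
rewrite /torus_label lt1 lt2; by case: odd.
Qed.

(** Factors off direction [s] are diagonal, so vertices differing there give 0 on both sides.
    Otherwise the parity factors above [s] multiply to the sign in [torus_sgn], and the twisted
    difference supplies multiplicity and direction. *)
Lemma direction_entry s u v :
  (if torus_along s u v then sgn R (@torus_orientation d m) u v *+ cycle_mult (u s) (v s)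
   else 0) = \prod_t direction_factor R (fun i => 2 * m i)%N s t (u t) (v t).
Proof.
have [/forallP agree|/forallPn[t]] :=
    boolP [forall t, (t != s) ==> (u t == v t)]; last first.
  rewrite negb_imply => /andP[ts uvt].
  rewrite ifF; last first.
    apply/negP => /andP[/forallP/(_ t)]; by rewrite uvt (negbTE ts).
  rewrite (bigD1 t) //= /direction_factor (negbTE ts).
  by case: ifP => _; rewrite mxE (negbTE uvt) mul0r.
have E : \prod_(t | t != s) direction_factor R (fun i => 2 * m i)%N s t (u t) (v t) =
    (-1) ^+ (\sum_(t < d | (s < t)%N) u t).
  rewrite expr_sum [RHS](bigID (fun t => t != s)) /= [X in _ * X]big1 ?mulr1; last first.
    by move=> t /andP[st]; rewrite negbK => /eqP ts; rewrite ts ltnn in st.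
  rewrite big_mkcond [RHS]big_mkcond; apply: eq_bigr => t _.
  case: eqVneq => [->|ts] /=; first by rewrite ltnn.
  have /eqP uvt := implyP (agree t) ts.
  rewrite /direction_factor (negbTE ts) uvt andbT.
  have [//|ts'|/val_inj e] := ltngtP t s; last by rewrite e eqxx in ts.
  - by rewrite mxE eqxx.
  - by rewrite mxE eqxx.
rewrite (bigD1 s) //= {}E /direction_factor ltnn eqxx mxE.
have along_s : torus_along s u v = (u s != v s) && (0 < cycle_mult (u s) (v s))%N.
  rewrite /torus_along /along /cycle_adj; congr (_ && _).
  apply/forallP/idP => [/(_ s)|us t]; first by rewrite eqxx eqb_id.
  have [->|ts] := eqVneq t s; first by rewrite us.
  by rewrite (implyP (agree t) ts).
have [us|us|/val_inj us] := ltngtP (u s) (v s).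
- case: ifP => [h|]; first by rewrite (torus_sgn h us) mulr_natl.
  rewrite along_s -val_eqE /= neq_ltn us /= lt0n => /negbFE/eqP ->.
  by rewrite mul0r.
- case: ifP => [h|]; last first.
    rewrite along_s -val_eqE /= neq_ltn us orbT /= lt0n => /negbFE/eqP ->.
    by rewrite oppr0 mul0r.
  (* The sign is read off the reversed pair; the exponents match because [u] and [v] agree in all
     directions above [s]. *)
  rewrite sgn_skew; last exact: torus_orientation_asym.
  rewrite (torus_sgn (s := s)) // 1?torus_along_sym // mulNrn mulNr mulr_natl.
  congr (- (_ ^+ _ *+ _)); apply: eq_bigr => t st.
  have ts : t != s by rewrite -val_eqE /= gtn_eqF.
  by have /eqP -> := implyP (agree t) ts.
- by rewrite along_s us eqxx mul0r.
Qed.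

Lemma torus_kasteleyn :
  fun_mx (fun u v => sgn R (@torus_orientation d m) u v * torus_edge_weight a u v) =
  kasteleyn_mx (fun i => 2 * m i)%N a.
Proof.
apply/matrixP => i j; rewrite summxE mxE /torus_edge_weight big_mkcond mulr_sumr.
apply: eq_bigr => s _; rewrite !mxE -direction_entry.
by case: ifP; rewrite ?mulr0 // !mulrnAr mulrC.
Qed.

End TorusMatrix.

(** * Folding the torus onto the index set of the product *)

Section FoldTorus.
Variables (d : nat) (m : 'I_d -> nat).
Hypothesis m0 : forall i, (0 < m i)%N.

Definition fold_cycle (k : nat) (k0 : (0 < k)%N) (p : 'I_(2 * k)) : 'I_k :=
  Ordinal (ltn_pmod p k0).

Lemma card_fold_cycle_fibre k (k0 : (0 < k)%N) (q : 'I_k) :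
  #|[pred p | fold_cycle k0 p == q]| = 2.
Proof.
have h1 : (q < 2 * k)%N by have := ltn_ord q; lia.
have h2 : (q + k < 2 * k)%N by have := ltn_ord q; lia.
transitivity #|pred2 (Ordinal h1) (Ordinal h2)|; last first.
  by rewrite card2 -val_eqE /=; have := ltn_ord q; lia.
apply: eq_card => p; rewrite !inE -!val_eqE /=.
have := ltn_ord p; have := ltn_ord q; have [pk|pk] := ltnP p k => hq hp.
  rewrite modn_small //; lia.
rewrite -[in (p %% k)%N](subnK pk) modnDr modn_small; lia.
Qed.

(** Moving [p] by [k] shifts the angle by pi, which changes only the sign of the sine. *)
Lemma sin2_angle_fold_cycle (R : realType) k (k0 : (0 < k)%N) (p : 'I_(2 * k)) :
  sin (angle R (2 * k) p) ^+ 2 = sin (angle R (2 * k) (fold_cycle k0 p)) ^+ 2.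
Proof.
have -> : angle R (2 * k) p = angle R (2 * k) (fold_cycle k0 p) + (p %/ k)%:R * pi.
  have kR : k%:R != 0 :> R by rewrite pnatr_eq0 -lt0n.
  rewrite /angle /= {1}(divn_eq p k) -!natr1 natrD !natrM; field.
  by rewrite kR.
by rewrite sin_add_natpi exprMn sqrr_sign mul1r.
Qed.

Definition fold_torus (v : torus m) : {dffun forall s : 'I_d, 'I_(m s)} :=
  [ffun s => fold_cycle (m0 s) (v s)].

(** A fibre is a product of two-element fibres, one per direction. *)
Lemma card_fold_torus_fibre i : #|[pred v | fold_torus v == i]| = (2 ^ d)%N.
Proof.
transitivity #|(family (fun s => [pred p : 'I_(2 * m s) | fold_cycle (m0 s) p == i s])
               : simpl_pred (torus m))|.
  apply: eq_card => v; rewrite !inE; apply/eqP/familyP => [<- s|h].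
    by rewrite !inE ffunE.
  by apply/ffunP => s; rewrite ffunE; apply/eqP; have := h s; rewrite inE.
rewrite card_family foldrE big_image /=.
rewrite (eq_bigr (fun=> 2)) => [|s _]; last exact: card_fold_cycle_fibre.
by rewrite prod_nat_const card_ord.
Qed.

Lemma prod_fold_torus (R : comNzRingType) (F : {dffun forall s : 'I_d, 'I_(m s)} -> R) :
  \prod_(v : torus m) F (fold_torus v) = \prod_i F i ^+ (2 ^ d).
Proof.
rewrite (partition_big fold_torus predT) //=; apply: eq_bigr => i _.
rewrite -(card_fold_torus_fibre i) -prodr_const.
by apply: eq_big => [v|v /eqP -> //]; rewrite inE.
Qed.

End FoldTorus.

Theorem theorem3p5 (R : realType) (d : nat) (m : 'I_d -> nat)
    (hd : (1 <= d)%N) (hm : forall i, (0 < m i)%N) (x : R) (a : 'I_d -> R) :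
  partition_function (@torus_adj d m) (@torus_orientation d m)
      (fun _ => x) (@torus_edge_weight d m R a) =
  \prod_(i : {dffun forall s : 'I_d, 'I_(m s)})
    (x ^+ 2 + \sum_(s < d) 4 * a s ^+ 2 *
       sin ((2 * (i s).+1%:R - 1) * pi / (2 * (m s)%:R)) ^+ 2) ^+ (2 ^ (d - 1)).
Proof.
rewrite (partition_function_perm (O := @torus_orientation d m)); first last.
- exact: torus_edge_weight_sym.
- exact: torus_orientation_asym.
- exact: torus_orientation_adj.
- exact: torus_adj_sym.
rewrite -det_fun_mx.
pose w (u v : torus m) := sgn R (@torus_orientation d m) u v * torus_edge_weight a u v.
have Ew u v : w v u = - w u v.
  rewrite /w (torus_edge_weight_sym a v u).
  by rewrite (sgn_skew R (@torus_orientation_asym d m) u v) mulNr.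
have -> : fun_mx (signed_adjacency (@torus_orientation d m) (fun=> x) (torus_edge_weight a)) =
    x%:M + fun_mx w.
  apply/matrixP => i j; rewrite !mxE /signed_adjacency (inj_eq enum_val_inj).
  case: eqVneq => [->|ij]; last by rewrite mulr0n add0r.
  (* Skewness in characteristic 0 makes the diagonal of [w] vanish. *)
  have /eqP := Ew (enum_val j) (enum_val j); rewrite -addr_eq0 -mulr2n mulrn_eq0 /=.
  by move=> /eqP ->; rewrite mulr1n addr0.
apply: det_skew x => [|x].
  by apply/matrixP => i j; rewrite !mxE Ew.
rewrite torus_kasteleyn kasteleyn_det; last 2 first.
- by move=> i; have := hm i; lia.
- by move=> i; rewrite mul2n odd_double.
(* The squared determinant asks for the exponent 2^(d-1) times 2, which is the fibre size 2^d
   because d is positive. *)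
rewrite -expnSr subn1 prednK // -(prod_fold_torus hm); apply: eq_bigr => v _.
congr (_ + _); apply: eq_bigr => s _; congr (_ * _).
by rewrite (sin2_angle_fold_cycle R (hm s)) ffunE /angle natrM.
Qed.
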